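(* There exists an absolute constant $c>0$ such that for every positive integer $k$ there exist a graph $G=(V,E,\ell)$ with nonnegative edge lengths and a set $R\subseteq V$ of $k$ terminals with the following property: every distance-preserving minor $G'=(V',E',\ell')$ of $G$ with respect to $R$ such that $V'\subseteq V$ and $d_{G'}(u,v)\ge d_G(u,v)$ for all $u,v\in V'$ has at least $c\,k^4$ vertices.
   Context: $d_H$ denotes shortest-path distance in a graph $H$ with respect to its edge lengths. Given a graph $G=(V,E,\ell)$ and terminals $R\subseteq V$, a distance-preserving minor of $G$ with respect to $R$ is a graph $G'$ with edge lengths $\ell'$ (which may differ from $\ell$) such that $G'$ is a minor of $G$ in which the terminals survive (terminals are never deleted and no two terminals are merged; a terminal may be merged with non-terminals by contraction and the resulting vertex is identified with that terminal), so $R\subseteq V(G')$, and $d_{G'}(u,v)=d_G(u,v)$ for all $u,v\in R$. The condition $V'\subseteq V$ means that every vertex of the minor $G'$ is identified with a vertex of $G$ (e.g., contracting an edge $(u,v)$ into $v$ yields a vertex identified with $v$), so that $d_G(u,v)$ makes sense for $u,v\in V'$. *)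

(* Defs.v *)
From HB Require Import structures.
From mathcomp Require Import all_boot all_order all_algebra.
From mathcomp Require Import classical_sets reals ereal.

Set Implicit Arguments.
Unset Strict Implicit.
Unset Printing Implicit Defensive.

Import Order.TTheory GRing.Theory Num.Theory.

Local Open Scope ring_scope.

(* A finite simple undirected graph whose vertex set is a subset of the
   ambient finite type T, so that a graph and its minors can share vertices. *)
Record sgraph (T : finType) := SGraph {
  vert : {set T};
  edges : {set {set T}};
  edgesP : forall e, e \in edges -> #|e| = 2%N /\ e \subset vert }.

Section Operations.
Variable T : finType.
Implicit Type G : sgraph T.

Fact del_edge_subproof G (e0 : {set T}) e :
  e \in edges G :\ e0 -> #|e| = 2%N /\ e \subset vert G.
Proof. by case/setD1P=> _ /edgesP. Qed.

Definition del_edge G (e0 : {set T}) : sgraph T :=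
  SGraph (@del_edge_subproof G e0).

Fact del_vertex_subproof G (x : T) e :
  e \in [set e : {set T} in edges G | x \notin e] ->
  #|e| = 2%N /\ e \subset vert G :\ x.
Proof.
by rewrite inE => /andP[/edgesP[e2 eG] xe]; split; rewrite // subsetD1 eG.
Qed.

Definition del_vertex G (x : T) : sgraph T := SGraph (@del_vertex_subproof G x).

Definition merge_into (u v x : T) : T := if x == u then v else x.

Fact contract_edge_subproof G (u v : T) (uvG : [set u; v] \in edges G) e :
  e \in [set e : {set T} in
            [set merge_into u v @: f | f : {set T} in edges G] | #|e| == 2%N] ->
  #|e| = 2%N /\ e \subset vert G :\ u.
Proof.
have [uv2 uvV] := edgesP uvG.
have uDv : v != u by move: uv2; rewrite cards2 eq_sym; case: eqP.
rewrite inE => /andP[/imsetP[f fG ->] /eqP f2]; split=> //.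
have [_ /fintype.subsetP fV] := edgesP fG.
apply/fintype.subsetP=> _ /imsetP[x xf ->]; rewrite /merge_into in_setD1.
case: (eqVneq x u) => [_|xu]; last by rewrite xu fV.
by rewrite uDv (fintype.subsetP uvV) // !inE eqxx orbT.
Qed.

(* Contraction of the edge {u, v} into v: the merged vertex keeps the name v;
   loops are dropped and parallel edges are identified. *)
Definition contract_edge G (u v : T) (uvG : [set u; v] \in edges G) : sgraph T :=
  SGraph (@contract_edge_subproof G u v uvG).

(* In [minor_contract], u may not be a terminal, but v may: two terminals are
   never merged, and a terminal merged with a non-terminal keeps its name. *)
Inductive minor (K : {set T}) (G : sgraph T) : sgraph T -> Prop :=
| minor_refl : minor K G G
| minor_del_edge H (e : {set T}) : minor K G H -> minor K G (del_edge H e)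
| minor_del_vertex H (x : T) :
    minor K G H -> x \notin K -> minor K G (del_vertex H x)
| minor_contract H (u v : T) (uvH : [set u; v] \in edges H) :
    minor K G H -> u \notin K -> minor K G (contract_edge uvH).

End Operations.

(* The values of [len] outside the edge set are irrelevant. *)
Record wgraph (R : realType) (T : finType) := WGraph {
  graph_of :> sgraph T;
  len : {set T} -> R;
  len_ge0 : forall e, e \in edges graph_of -> 0 <= len e }.

Section Distance.
Variables (R : realType) (T : finType).
Implicit Type G : wgraph R T.

(* u :: p is a simple path of G from u to v. *)
Definition is_path G (u v : T) (p : seq T) : bool :=
  [&& path (fun x y => [set x; y] \in edges G) u p, last u p == v
    & uniq (u :: p)].

Definition path_len G (u : T) (p : seq T) : R :=
  \sum_(l <- pairmap (fun x y => len G [set x; y]) u p) l.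

(* The value is +oo when u and v are not connected. *)
Definition dist G (u v : T) : \bar R :=
  ereal_inf [set (path_len G u p)%:E | p in [set p | is_path G u v p]]%classic.

Definition distance_preserving_minor (K : {set T}) G G' : Prop :=
  minor K G G' /\
  (forall u v, u \in K -> v \in K -> dist G' u v = dist G u v).

End Distance.

(* Main.v *)
(* Put terminals s_i = (0, 2^i L) and t_j = (L, 2^j L) on two vertical lines and
   join each s_i to each t_j by the lattice points of a straight line; L is
   divisible enough for all lines to cross at lattice points.  An edge of slope
   d has length M + 2 d^2, so by convexity straight lines are the only geodesics.
   - Since G' dominates the distances of G, a shortest s_i-t_j path of G' only
     visits vertices of the line from s_i to t_j.
   - If two lines cross, their paths in G' share a vertex, which must be the
     crossing point: otherwise, undoing the minor operations gives two disjoint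
     connected subgraphs of G joining the same terminals, and a parity argument
     on the layers of G excludes this.
   - No three lines pass through a point with 0 < x < L, since the equation
     p 2^i + q 2^j = y has at most two solutions (i, j) for p, q > 0.
   So of the order of k^4 crossing points survive in G'. *)
Require Import Defs.
From HB Require Import structures.
From mathcomp Require Import all_boot all_order all_algebra.
From mathcomp Require Import classical_sets reals ereal.
From mathcomp Require Import zify ring lra.

Import Order.TTheory GRing.Theory Num.Theory.

Local Open Scope ring_scope.

(** * Geodesics and potentials *)

Section Geodesics.
Variables (R : realType) (T : finType).
Implicit Types (G : wgraph R T) (u v : T) (p : seq T).

Lemma path_len_cons G u v p :
  path_len G u (v :: p) = len G [set u; v] + path_len G v p.
Proof. by rewrite /path_len /= big_cons. Qed.

(** A simple path has at most [#|T|] vertices, so there are finitely many and the infimum is a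
    minimum; a finite bound on [dist] excludes the empty set, whose infimum is [+oo]. *)
Lemma dist_attained G u v (r : R) :
  (dist G u v <= r%:E)%E -> exists2 p, is_path G u v p & path_len G u p <= r.
Proof.
move=> le_r; pose P (p : #|T|.-bseq T) := is_path G u v p.
have bseqP p : is_path G u v p -> exists2 q, P q & p = q :> seq T.
  move=> pP; have /and3P[_ _ /card_uniqP up_card] := pP.
  have sz : (size p <= #|T|)%N.
    by move: (max_card (mem (u :: p))); rewrite up_card /= => /ltnW.
  by exists (Bseq sz).
case: (pickP P) => [q0 Pq0|P0]; last first.
  suff d : dist G u v = +oo%E by rewrite d in le_r.
  apply/ereal_inf_pinfty => x [p /bseqP[q Pq _] _].
  by move: (P0 q); rewrite Pq.
case: (@arg_minP _ _ _ q0 P (fun q => path_len G u q) Pq0) => q Pq qmin.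
exists q => //; rewrite -lee_fin; apply: Order.le_trans le_r.
apply: le_ereal_inf_tmp => _ [p /bseqP[q' Pq' ->] <-].
by rewrite lee_fin qmin.
Qed.

(** Both parts telescope: on a path no longer than its gain in [phi], no edge has slack, and [psi]
    is constant along edges without slack. *)
Lemma path_len_potential G (phi psi : T -> R) :
  (forall x y, [set x; y] \in edges G ->
     phi y - phi x <= len G [set x; y] /\
     (len G [set x; y] <= phi y - phi x -> psi x = psi y)) ->
  forall u p, path (fun x y => [set x; y] \in edges G) u p ->
    phi (last u p) - phi u <= path_len G u p /\
    (path_len G u p <= phi (last u p) - phi u ->
       forall x, x \in p -> psi x = psi u).
Proof.
move=> tight u p; elim: p u => [|v p IH] u /=.
  by rewrite /path_len big_nil subrr.
case/andP=> uv /IH[le_p psi_p]; have [le_uv psi_uv] := tight _ _ uv.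
rewrite path_len_cons; split=> [|le_up x]; first lra.
have vu : psi v = psi u by rewrite psi_uv //; lra.
by rewrite inE => /predU1P[-> //|xp]; rewrite psi_p //; lra.
Qed.

Lemma path_vert (G : sgraph T) u p x :
  path (fun x y => [set x; y] \in edges G) u p -> p != [::] ->
  x \in u :: p -> x \in vert G.
Proof.
elim: p u => // v p IH u /= /andP[uv vp] _.
have [_ /fintype.subsetP uvV] := edgesP uv.
rewrite inE => /predU1P[->|]; first by apply: uvV; rewrite !inE eqxx.
case: p IH vp => [|w p] IH vp; last exact: IH.
by rewrite inE => /eqP ->; apply: uvV; rewrite !inE eqxx orbT.
Qed.

(* The edges of [G'] need not come from edges of [G], but their lengths dominate
   distances of [G], so the potential bounds them too. *)
Lemma dominating_geodesic G G' (phi psi : T -> R) s t :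
  (forall x y, [set x; y] \in edges G ->
     phi y - phi x <= len G [set x; y] /\
     (len G [set x; y] <= phi y - phi x -> psi x = psi y)) ->
  (forall u v, u \in vert G' -> v \in vert G' ->
     (dist G u v <= dist G' u v)%E) ->
  (dist G' s t <= (phi t - phi s)%:E)%E ->
  exists p, [/\ path (fun x y => [set x; y] \in edges G') s p,
               last s p = t & forall x, x \in p -> psi x = psi s].
Proof.
move=> tight dom /dist_attained[p /and3P[sp /eqP pt _] le_p].
exists p; split=> //.
suff tight' x y : [set x; y] \in edges G' ->
     phi y - phi x <= len G' [set x; y] /\
     (len G' [set x; y] <= phi y - phi x -> psi x = psi y).
  have [_] := path_len_potential _ _ _ tight' _ _ sp.
  by apply; rewrite pt.
move=> xy; have [xy2 /fintype.subsetP xyV] := edgesP xy.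
have xV : x \in vert G' by apply: xyV; rewrite !inE eqxx.
have yV : y \in vert G' by apply: xyV; rewrite !inE eqxx orbT.
have yx : y != x by move: xy2; rewrite cards2 eq_sym; case: eqP.
(* The edge is itself a simple path of [G'], so domination yields a path of [G] from [x] to [y] that
   is no longer than the edge. *)
have : (dist G x y <= (len G' [set x; y])%:E)%E.
  apply: Order.le_trans (dom _ _ xV yV) _; apply: ereal_inf_lbound.
  exists [:: y].
    by rewrite /is_path /= xy eqxx inE eq_sym yx.
  by rewrite path_len_cons /path_len big_nil addr0.
case/dist_attained=> q /and3P[xq /eqP qy _] le_q.
have [le1 psiE] := path_len_potential _ _ _ tight _ _ xq.
rewrite qy in le1 psiE; split=> [|le2]; first lra.
rewrite -(psiE _ y) //; first lra.
by move: (mem_last x q); rewrite qy inE (negPf yx).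
Qed.

Lemma dist_le_tight_path G (phi : T -> R) u v p :
  path (fun x y => ([set x; y] \in edges G) &&
                   (len G [set x; y] == phi y - phi x)) u p ->
  last u p = v -> uniq (u :: p) ->
  (dist G u v <= (phi v - phi u)%:E)%E.
Proof.
move=> up pv upu; have <- : path_len G u p = phi v - phi u.
  elim: p u up pv {upu} => [|w p IH] u /=.
    by move=> _ ->; rewrite /path_len big_nil subrr.
  case/andP=> /andP[_ /eqP uw] wp pv.
  by rewrite path_len_cons uw IH //; lra.
apply: ereal_inf_lbound; exists p => //.
apply/and3P; split=> //; last exact/eqP.
by apply: sub_path up => x y /andP[].
Qed.

End Geodesics.

(** * Pulling disjoint connected sets back through minor operations *)

Section Linkage.
Variable T : finType.
Implicit Types (G H : sgraph T) (A B : {set T}).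

(** Only the ends of actual steps must lie in [A]: [linked G A x x] holds for every [x]. *)
Definition linked G A : rel T :=
  connect [rel x y | [&& [set x; y] \in edges G, x \in A & y \in A]].

Lemma linked_sub G H A :
  edges H \subset edges G -> forall x y, linked H A x y -> linked G A x y.
Proof.
move=> /fintype.subsetP HG x y; apply: connect_sub => {}x {}y /and3P[xy xA yA].
by apply: connect1; rewrite /= HG // xA.
Qed.

(** This is the preimage of [A] under [merge_into u v], which is why disjointness is kept. *)
Definition uncontract (u v : T) A := if v \in A then u |: A else A :\ u.

Lemma uncontract_disjoint u v A B :
  [disjoint A & B] -> [disjoint uncontract u v A & uncontract u v B].
Proof.
rewrite -!setI_eq0 => /eqP AB0; apply/eqP/setP=> x.
move/setP: AB0 => /[dup] /(_ x) + /(_ v); rewrite !inE /uncontract.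
case: (v \in A); case: (v \in B) => //= xAB _; rewrite !inE; move: xAB;
  by case: (x == u); case: (x \in A); case: (x \in B).
Qed.

(** Each edge of the contraction is the image of an edge of [H]; where an end was moved from [u] to
    [v], the edge [[set u; v]] bridges the gap, and both its ends lie in the preimage of [A]. *)
Lemma linked_contract H (u v : T) (uvH : [set u; v] \in edges H) A x y :
  linked (contract_edge uvH) A x y -> linked H (uncontract u v A) x y.
Proof.
have sym : connect_sym
    [rel x y | [&& [set x; y] \in edges H,
                   x \in uncontract u v A & y \in uncontract u v A]].
  apply: sym_connect_sym => a b /=; rewrite finset.setUC; congr (_ && _).
  exact: andbC.
apply: connect_sub => {}x {}y /and3P[xy xA yA].
have mergeA a b : b = merge_into u v a -> b \in A ->
    a \in uncontract u v A /\ linked H (uncontract u v A) a b.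
  rewrite /merge_into; case: eqP => [-> ->|/eqP au -> aA].
    rewrite /uncontract => vA; rewrite vA; split; first exact: setU11.
    by apply: connect1; rewrite /= uvH setU11 finset.setU1r.
  split; last exact: connect0.
  by rewrite /uncontract; case: ifP => _; rewrite !inE ?au aA ?orbT.
move: xy; rewrite inE => /andP[/imsetP[f fH fE] /eqP xy2].
have xDy : x != y by move: xy2; rewrite cards2; case: eqP.
have /imsetP[a af xa] : x \in merge_into u v @: f.
  by rewrite -fE !inE eqxx.
have /imsetP[b bf yb] : y \in merge_into u v @: f.
  by rewrite -fE !inE eqxx orbT.
have aDb : a != b by apply: contraNneq xDy => ab; rewrite xa yb ab.
have fab : f = [set a; b].
  apply/esym/eqP; rewrite eqEcard; have [-> _] := edgesP fH.
  by rewrite cards2 aDb finset.subUset !finset.sub1set af bf.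
have [aA ax] := mergeA _ _ xa xA; have [bA yb'] := mergeA _ _ yb yA.
apply: (@connect_trans _ _ a); first by rewrite sym.
apply: connect_trans yb'; apply: connect1.
by rewrite /= -fab fH aA.
Qed.

(** [A'] and [B'] are iterated preimages, unchanged by deletions. The linked vertices keep their
    names throughout, so this applies to paths between terminals. *)
Lemma minor_linked K G H A B :
  minor K G H -> [disjoint A & B] ->
  exists A' B', [/\ [disjoint A' & B'],
    forall x y, linked H A x y -> linked G A' x y &
    forall x y, linked H B x y -> linked G B' x y].
Proof.
move=> GH; elim: GH A B => {H} [|H e _ IH|H x _ IH _|H u v uvH _ IH _] A B AB.
- by exists A, B.
- have sub : edges (del_edge H e) \subset edges H by exact: subD1set.
  have [A' [B' [AB' HA HB]]] := IH _ _ AB; exists A', B'; split=> // x y;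
    by move/(linked_sub _ _ _ sub); (apply: HA || apply: HB).
- have sub : edges (del_vertex H x) \subset edges H.
    by apply/fintype.subsetP=> e; rewrite inE => /andP[].
  have [A' [B' [AB' HA HB]]] := IH _ _ AB; exists A', B'; split=> // y z;
    by move/(linked_sub _ _ _ sub); (apply: HA || apply: HB).
- have [A' [B' [AB' HA HB]]] := IH _ _ (uncontract_disjoint u v _ _ AB).
  exists A', B'; split=> // x y;
    by move/linked_contract; (apply: HA || apply: HB).
Qed.

Lemma path_linked G A s p :
  path (fun x y => [set x; y] \in edges G) s p -> {subset s :: p <= A} ->
  linked G A s (last s p).
Proof.
elim: p s => [|v p IH] s /=; first by move=> *; exact: connect0.
case/andP=> sv vp subA; apply: connect_trans (IH _ vp _); last first.
  by move=> x xp; apply: subA; rewrite inE xp orbT.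
by apply: connect1; rewrite /= sv !subA // !inE eqxx ?orbT.
Qed.

End Linkage.

Arguments linked {T}.

(** * Parity of walks in a layered graph whose edges do not cross *)

Section Layered.
Variables (T : finType) (G : sgraph T) (col ht : T -> nat) (L : nat).
Variable fwd : rel T.
Hypothesis edge_fwd : forall x y, [set x; y] \in edges G -> fwd x y || fwd y x.
Hypothesis fwd_col : forall x y, fwd x y -> col y = (col x).+1.
Hypothesis col_le : forall x, (col x <= L)%N.
Hypothesis fwd_mono : forall u v u' v', fwd u v -> fwd u' v' ->
  col u = col u' -> (ht u < ht u')%N -> (ht v <= ht v')%N.
Hypothesis col_ht_inj : forall u v, col u = col v -> ht u = ht v -> u = v.

Definition steps_parity (f : rel T) (s : T) (p : seq T) : bool :=
  \big[addb/false]_(b <- pairmap f s p) b.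

(** A step counts in [outs v], respectively [ins v], when it traverses in either direction a forward
    edge whose tail, respectively head, lies below [v] in the layer of [v]. *)
Let below v x := (col x == col v) && (ht x < ht v)%N.
Let out_below v x y := fwd x y && below v x.
Let in_below v x y := fwd x y && below v y.
Let outs v x y := out_below v x y (+) out_below v y x.
Let ins v x y := in_below v x y (+) in_below v y x.

Lemma fwd_asym x y : fwd x y -> fwd y x = false.
Proof.
by move=> xy; apply/negP => /fwd_col; rewrite (fwd_col _ _ xy); lia.
Qed.

(* A walk enters and leaves each layer, except where it starts and ends. *)
Lemma outs_ins_parity v s p :
  path (fun x y => [set x; y] \in edges G) s p ->
  steps_parity (outs v) s p (+) steps_parity (ins v) s p =
  below v s (+) below v (last s p).
Proof.
elim: p s => [|y p IH] s /=; first by rewrite /steps_parity !big_nil !addbb.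
case/andP=> sy yp; rewrite /steps_parity /= !big_cons.
rewrite addbACA [X in _ (+) X](IH _ yp) addbA; congr (_ (+) _).
suff -> : outs v s y (+) ins v s y = below v s (+) below v y.
  by rewrite addbK.
rewrite /outs /ins /out_below /in_below.
case/orP: (edge_fwd _ _ sy) => sy'; rewrite sy' (fwd_asym _ _ sy') /=.
  by rewrite !addbF.
by rewrite addbC.
Qed.

(** Forward edges from one layer do not cross, and heights are injective on a layer; so an edge
    sharing neither tail nor head with [u]-[v] has both ends below it or neither. *)
Lemma fwd_below u v x y :
  fwd u v -> fwd x y -> x != u -> y != v -> below u x = below v y.
Proof.
move=> uv xy xu yv; rewrite /below (fwd_col _ _ uv) (fwd_col _ _ xy) eqSS.
case: eqP => //= cxu; apply/idP/idP => h.
- have := fwd_mono _ _ _ _ xy uv cxu h.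
  rewrite leq_eqVlt => /predU1P[hyv|//]; case/eqP: yv; apply: col_ht_inj => //.
  by rewrite (fwd_col _ _ uv) (fwd_col _ _ xy) cxu.
- rewrite ltnNge; apply/negP; rewrite leq_eqVlt => /predU1P[hux|hux].
    by case/eqP: xu; apply: col_ht_inj.
  have := fwd_mono _ _ _ _ uv xy (esym cxu) hux; lia.
Qed.

Lemma fwd_parity u v s p :
  path (fun x y => [set x; y] \in edges G) s p -> fwd u v ->
  u \notin s :: p -> v \notin s :: p ->
  steps_parity (outs u) s p = steps_parity (ins v) s p.
Proof.
move=> + uv; elim: p s => [|y p IH] s /=.
  by rewrite /steps_parity !big_nil.
case/andP=> sy yp; rewrite !(inE, negb_or) => /and3P[us uy up] /and3P[vs vy vp].
rewrite /steps_parity /= !big_cons; congr (_ (+) _); last first.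
  by apply: IH; rewrite // !inE negb_or ?uy ?vy.
rewrite /outs /ins /out_below /in_below.
have [sy'|nsy] := boolP (fwd s y); last first.
  have := edge_fwd _ _ sy; rewrite (negPf nsy) /= => ys.
  by rewrite ys /= (fwd_below _ _ _ _ uv ys) // eq_sym.
by rewrite (fwd_asym _ _ sy') /= (fwd_below _ _ _ _ uv sy') // eq_sym.
Qed.

(** An invariant of walks that avoid [A] separates [s'] from [t']. At a vertex before the last layer
    it is the parity of [outs]; in the last layer, which no forward edge leaves, the term
    [below v t] takes over. *)
Lemma layered_paths_meet (A B : {set T}) s t s' t' :
  [disjoint A & B] -> (0 < L)%N ->
  col s = 0%N -> col s' = 0%N -> col t = L -> col t' = L ->
  (ht s < ht s')%N -> (ht t' < ht t)%N ->
  linked G A s t -> linked G B s' t' -> False.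
Proof.
move=> dAB L0 cs cs' ct ct' hs ht_t /connectP[p0 sp tp] /connectP[q sq tq].
have p_edges : path (fun x y => [set x; y] \in edges G) s p0.
  by apply: sub_path sp => x y /and3P[].
(* The walk has a step because its ends lie in different layers; hence each of its vertices is the
   end of a step and lies in [A]. *)
have pA x : x \in s :: p0 -> x \in A.
  case: p0 sp tp {p_edges} => [|y p] /=.
    by move=> _ ts; move: ct; rewrite ts cs; lia.
  case/andP=> /and3P[_ sA yA] yp _; rewrite inE => /predU1P[-> //|].
  elim: p y yA yp => [|z p IH] y yA /=; first by rewrite inE => _ /eqP ->.
  case/andP=> /and3P[_ _ zA] zp; rewrite inE => /predU1P[-> //|].
  exact: IH.
have Bp x : x \in B -> x \notin s :: p0.
  by move=> xB; apply: contraL xB => /pA xA; rewrite (disjointFr dAB xA).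
(* [inv v] tells whether [v] lies above the walk. *)
pose inv v := steps_parity (outs v) s p0 (+) below v t.
have inv_fwd u v : fwd u v -> u \in B -> v \in B -> inv u = inv v.
  move=> uv uB vB; rewrite /inv (fwd_parity _ _ _ _ p_edges uv) ?Bp //.
  have := outs_ins_parity v _ _ p_edges; rewrite -tp.
  have -> : below v s = false by rewrite /below cs (fwd_col _ _ uv).
  have -> : below u t = false.
    apply/negP => /andP[/eqP cu _].
    by have := col_le v; rewrite (fwd_col _ _ uv); lia.
  by case: (steps_parity _ _ _); case: (steps_parity _ _ _); case: (below v t).
have inv_q : inv s' = inv t'.
  rewrite {}tq; elim: q s' sq {cs' hs} => // y q IH x /=.
  case/andP=> /and3P[xy xB yB] /IH <-.
  by case/orP: (edge_fwd _ _ xy) => /inv_fwd ->.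
have inv_s' : inv s' = true.
  rewrite /inv; have := outs_ins_parity s' _ _ p_edges; rewrite -tp.
  have -> : below s' s by rewrite /below cs cs' eqxx.
  have -> : below s' t = false by rewrite /below ct cs'; lia.
  suff -> : steps_parity (ins s') s p0 = false by rewrite !addbF.
  rewrite /steps_parity.
  elim: p0 s {sp tp p_edges pA Bp inv inv_fwd inv_q cs hs} => [|y p IH] s /=.
    by rewrite big_nil.
  rewrite big_cons IH /ins /in_below /below cs'.
  by case: (boolP (fwd s y)) => [/fwd_col ->|_];
    case: (boolP (fwd y s)) => [/fwd_col ->|_].
have inv_t' : inv t' = false.
  rewrite /inv; have -> : below t' t = false by rewrite /below; lia.
  rewrite /steps_parity addbF.
  elim: p0 s {sp tp p_edges pA Bp inv inv_fwd inv_q inv_s' cs hs}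
    => [|y p IH] s /=; first by rewrite big_nil.
  rewrite big_cons IH /outs /out_below /below ct'.
  have fwd_lt x z : fwd x z -> (col x == L) = false.
    by move=> /fwd_col xz; have := col_le z; rewrite xz => /ltn_eqF.
  by case: (boolP (fwd s y)) => [/fwd_lt ->|_];
    case: (boolP (fwd y s)) => [/fwd_lt ->|_].
by move: inv_q; rewrite inv_s' inv_t'.
Qed.

End Layered.

(** * Crossings of lines and equations in powers of two *)

Definition line_ht (L a b x : nat) : nat := (a * (L - x) + b * x)%N.

(* Two lines of heights [a], [a'] at abscissa [0] and [b], [b'] at abscissa [L]
   cross at abscissa [L (a' - a) / (a' - a + b - b')]. *)
Lemma line_ht_mono (L a b a' b' x : nat) :
  (forall d, (0 < d <= a' + b)%N -> (d %| L)%N) -> (x < L)%N ->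
  (line_ht L a b x < line_ht L a' b' x)%N ->
  (line_ht L a b x.+1 <= line_ht L a' b' x.+1)%N.
Proof.
rewrite /line_ht => Ldiv xL lt1; rewrite leqNgt; apply/negP => lt2.
have [p Lp] : exists p, L = (x + p).+1 by exists (L - x).-1; lia.
have e1 : (L - x = p.+1)%N by lia.
have e2 : (L - x.+1 = p)%N by lia.
rewrite e1 in lt1; rewrite e2 in lt2.
have dlt : (a + b' < a' + b)%N by lia.
have /Ldiv/dvdnP[q Lq] : (0 < (a' + b) - (a + b') <= a' + b)%N by lia.
have h1 : (x * (a' + b - (a + b')) + a * L < a' * L)%N by rewrite {1}Lp; nia.
have h2 : (a' * L < x.+1 * (a' + b - (a + b')) + a * L)%N by rewrite {1}Lp; nia.
move: h1 h2 dlt; rewrite Lq; move: (a' + b - (a + b'))%N => d h1 h2 dlt.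
have [aa|aa] := leqP a a'; last by nia.
(* The crossing abscissa [(a' - a) * q] would be an integer strictly between [x] and [x.+1]. *)
have h3 : (x * d < (a' - a) * q * d)%N by nia.
have h4 : ((a' - a) * q * d < x.+1 * d)%N by nia.
by move: h3 h4; rewrite !ltn_mul2r; lia.
Qed.

Lemma ltn_exp2_double i j : (i < j)%N -> (2 * 2 ^ i <= 2 ^ j)%N.
Proof. by move=> ij; rewrite -expnS leq_exp2l. Qed.

(** As [b2 < b1], the term [2 ^ b2 * q] is at most the drop [(2 ^ b1 - 2 ^ b2) * q], which equals
    the rise [(2 ^ a2 - 2 ^ a1) * p]. Hence [y < 2 * 2 ^ a2 * p <= 2 ^ a3 * p <= y]. *)
Lemma no_three_exp2_collinear (p q a1 a2 a3 b1 b2 b3 y : nat) :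
  (0 < p)%N -> (a1 < a2 < a3)%N ->
  (2 ^ a1 * p + 2 ^ b1 * q = y)%N -> (2 ^ a2 * p + 2 ^ b2 * q = y)%N ->
  (2 ^ a3 * p + 2 ^ b3 * q = y)%N -> False.
Proof.
move=> p0 /andP[/ltn_exp2_double a12 /ltn_exp2_double a23] y1 y2 y3.
have A1 : (0 < 2 ^ a1)%N by rewrite expn_gt0.
have b21 : (2 * 2 ^ b2 <= 2 ^ b1)%N.
  apply: ltn_exp2_double; rewrite -(ltn_exp2l (m := 2)) //; nia.
nia.
Qed.

(** * The graph of lines and its geodesics *)

Section Gadget.
Variables (n m L : nat).

(** The box contains every line with [i < n] and [j < m], so on these lines [inord] in [mknode]
    never returns its default value. Lattice points on no line are isolated vertices. *)
Definition node : finType := ('I_L.+1 * 'I_((2 ^ n + 2 ^ m) * L).+1)%type.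
Definition xcoord (v : node) : nat := v.1.
Definition ycoord (v : node) : nat := v.2.
Definition mknode (x y : nat) : node := (inord x, inord y).

Definition online (i j : nat) (v : node) : bool :=
  ycoord v == line_ht L (2 ^ i) (2 ^ j) (xcoord v).

Definition step (u v : node) : bool :=
  (xcoord v == (xcoord u).+1) &&
  [exists i : 'I_n, exists j : 'I_m, online i j u && online i j v].

Fact lines_graph_subproof (e : {set node}) :
  e \in [set [set w.1; w.2] | w in [set w : node * node | step w.1 w.2]] ->
  #|e| = 2%N /\ e \subset [set: node].
Proof.
case/imsetP=> -[u v]; rewrite inE /= => /andP[/eqP uv _] ->.
rewrite cards2; split; last by apply/fintype.subsetP => z _; rewrite inE.
suff -> : u != v by [].
by apply/eqP => vu; move: uv; rewrite vu => /n_Sn.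
Qed.

Definition lines_graph : sgraph node := SGraph lines_graph_subproof.

Lemma edge_step u v : [set u; v] \in edges lines_graph -> step u v || step v u.
Proof.
move=> /[dup] /edgesP[uv2 _] /imsetP[[x y]]; rewrite inE /= => xy uvE.
have uDv : u != v by move: uv2; rewrite cards2; case: eqP.
have: u \in [set x; y] by rewrite -uvE !inE eqxx.
have: v \in [set x; y] by rewrite -uvE !inE eqxx orbT.
rewrite !inE => /pred2P vxy /pred2P uxy; move: uDv.
by case: vxy uxy => -> [] ->; rewrite ?eqxx ?xy ?orbT.
Qed.

Lemma step_edge u v : step u v -> [set u; v] \in edges lines_graph.
Proof. by move=> uv; apply/imsetP; exists (u, v); rewrite // inE. Qed.

Lemma xcoord_le v : (xcoord v <= L)%N.
Proof. by rewrite -ltnS ltn_ord. Qed.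

Lemma step_xcoord u v : step u v -> xcoord v = (xcoord u).+1.
Proof. by case/andP=> /eqP. Qed.

Lemma node_inj u v : xcoord u = xcoord v -> ycoord u = ycoord v -> u = v.
Proof.
by case: u v => [x y] [x' y'] /= xx yy; congr pair; apply: val_inj.
Qed.

Definition source (i : nat) : node := mknode 0 (2 ^ i * L).
Definition target (j : nat) : node := mknode L (2 ^ j * L).
Definition line_node (i j x : nat) : node :=
  mknode x (line_ht L (2 ^ i) (2 ^ j) x).

Lemma xcoord_mknode x y : (x <= L)%N -> xcoord (mknode x y) = x.
Proof. by move=> xL; rewrite /xcoord /= inordK. Qed.

Lemma ycoord_mknode x y :
  (y <= (2 ^ n + 2 ^ m) * L)%N -> ycoord (mknode x y) = y.
Proof. by move=> yL; rewrite /ycoord /= inordK. Qed.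

Lemma ycoord_source i : (i < n)%N -> ycoord (source i) = (2 ^ i * L)%N.
Proof.
move=> i_n; rewrite ycoord_mknode // leq_mul2r; apply/orP; right.
have : (2 ^ i <= 2 ^ n)%N by rewrite leq_exp2l // ltnW.
lia.
Qed.

Lemma ycoord_target j : (j < m)%N -> ycoord (target j) = (2 ^ j * L)%N.
Proof.
move=> j_m; rewrite ycoord_mknode // leq_mul2r; apply/orP; right.
have : (2 ^ j <= 2 ^ m)%N by rewrite leq_exp2l // ltnW.
lia.
Qed.

Lemma line_node_source i j : line_node i j 0 = source i.
Proof. by rewrite /line_node /line_ht subn0 muln0 addn0. Qed.

Lemma line_node_target i j : line_node i j L = target j.
Proof. by rewrite /line_node /line_ht subnn muln0. Qed.

Lemma online_line_node i j x : (i < n)%N -> (j < m)%N -> (x <= L)%N ->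
  online i j (line_node i j x).
Proof.
move=> i_n j_m xL; rewrite /online xcoord_mknode // ycoord_mknode // /line_ht.
have : (2 ^ i <= 2 ^ n)%N by rewrite leq_exp2l // ltnW.
have : (2 ^ j <= 2 ^ m)%N by rewrite leq_exp2l // ltnW.
nia.
Qed.

Lemma step_line_node i j x : (i < n)%N -> (j < m)%N -> (x < L)%N ->
  step (line_node i j x) (line_node i j x.+1).
Proof.
move=> i_n j_m xL; rewrite /step !xcoord_mknode ?eqxx //; last exact: ltnW.
apply/existsP; exists (Ordinal i_n); apply/existsP; exists (Ordinal j_m) => /=.
by rewrite !online_line_node // ltnW.
Qed.

Variable R : realType.

(** Summing over ordered pairs makes the length a function of the unordered edge and counts the
    squared height difference twice. *)
Definition lines_len (e : {set node}) : R :=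
  (2 * (2 ^ n + 2 ^ m) ^ 2)%:R +
  \sum_(u in e) \sum_(v in e) ((ycoord u)%:R - (ycoord v)%:R) ^+ 2.

Fact lines_len_ge0 e : e \in edges lines_graph -> 0 <= lines_len e.
Proof.
move=> _; rewrite addr_ge0 ?ler0n //.
by apply: sumr_ge0 => u _; apply: sumr_ge0 => v _; rewrite sqr_ge0.
Qed.

Definition lines_wgraph : wgraph R node := WGraph lines_len_ge0.

Lemma lines_len2 u v : u != v ->
  lines_len [set u; v] =
  (2 * (2 ^ n + 2 ^ m) ^ 2)%:R + 2 * ((ycoord v)%:R - (ycoord u)%:R) ^+ 2.
Proof.
move=> uv; rewrite /lines_len; congr (_ + _).
rewrite big_setU1 ?inE //= big_set1 !big_setU1 ?inE //= !big_set1; ring.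
Qed.

Let slope (i j : nat) : R := (2 ^ j)%:R - (2 ^ i)%:R.
(* Every edge is at least as long as the increase of [phi] along it, and strictly
   longer unless it goes forward with slope [slope i j]. *)
Let phi i j v : R :=
  4 * slope i j * (ycoord v)%:R +
  ((2 * (2 ^ n + 2 ^ m) ^ 2)%:R - 2 * slope i j ^+ 2) * (xcoord v)%:R.
(** The height at abscissa 0 of the line of slope [slope i j] through [v]. *)
Let psi i j v : R := (ycoord v)%:R - slope i j * (xcoord v)%:R.

(** This is what makes every backward edge strictly longer than its gain in [phi]. *)
Lemma slope_bound i j : (i < n)%N -> (j < m)%N ->
  2 * slope i j ^+ 2 < (2 * (2 ^ n + 2 ^ m) ^ 2)%:R.
Proof.
move=> i_n j_m; rewrite natrM ltr_pM2l // natrX.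
have hi : (2 ^ i < 2 ^ n)%N by rewrite ltn_exp2l.
have hj : (2 ^ j < 2 ^ m)%N by rewrite ltn_exp2l.
have : `|slope i j| < (2 ^ n + 2 ^ m)%:R.
  have i0 : 0 <= (2 ^ i)%:R :> R by [].
  have j0 : 0 <= (2 ^ j)%:R :> R by [].
  rewrite natrD; move: hi hj; rewrite -!(ltr_nat R) /slope => hi hj.
  by rewrite ltr_norml; lra.
by move=> h; rewrite -[slope i j ^+ 2]real_normK ?num_real // ltr_pXn2r ?nnegrE.
Qed.

Lemma lines_len_potential i j : (i < n)%N -> (j < m)%N ->
  forall x y, [set x; y] \in edges lines_wgraph ->
    phi i j y - phi i j x <= len lines_wgraph [set x; y] /\
    (len lines_wgraph [set x; y] <= phi i j y - phi i j x ->
     psi i j x = psi i j y).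
Proof.
move=> i_n j_m x y /edge_step xy.
have sM := slope_bound _ _ i_n j_m.
have key u v : step u v -> u != v /\ (xcoord v)%:R = (xcoord u)%:R + 1 :> R.
  move=> /step_xcoord uv; rewrite uv -natr1; split=> //.
  by apply/eqP => e; move: uv; rewrite e; lia.
rewrite /phi /psi /=; case/orP: xy => /key[xDy cE].
(* Forward edge: length minus gain is [2 * (hy - hx - s) ^+ 2]. *)
- rewrite lines_len2 // {}cE; move: sM; move: (slope i j) => s.
  move: (_ * _)%:R (ycoord x)%:R (ycoord y)%:R (xcoord x)%:R => M hx hy cx sM.
  have := sqr_ge0 (hy - hx - s); split=> [|le_d]; first nra.
  suff : hy - hx - s = 0 by lra.
  by apply/eqP; rewrite -sqrf_eq0; apply/eqP; nra.
(* Backward edge: length minus gain is [2 * M - 4 * s ^+ 2 + 2 * (hy - hx - s) ^+ 2], which is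
   positive. *)
- rewrite finset.setUC lines_len2 // {}cE; move: sM; move: (slope i j) => s.
  move: (_ * _)%:R (ycoord x)%:R (ycoord y)%:R (xcoord y)%:R => M hx hy cy sM.
  by have := sqr_ge0 (hy - hx - s); split=> [|le_d]; nra.
Qed.

(** Along the nodes of the line, every edge length equals the gain in [phi]. *)
Lemma dist_source_target i j : (i < n)%N -> (j < m)%N ->
  (dist lines_wgraph (source i) (target j) <=
   (phi i j (target j) - phi i j (source i))%:E)%E.
Proof.
move=> i_n j_m; pose p x c := map (line_node i j) (iota x.+1 c).
have last_p x c : last (line_node i j x) (p x c) = line_node i j (x + c).
  by elim: c x => [|c IH] x /=; rewrite ?addn0 // IH addSnnS.
apply: (@dist_le_tight_path _ _ _ _ _ _ (p 0%N L)); last 2 first.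
- by rewrite -(line_node_source i j) last_p add0n line_node_target.
- rewrite -(line_node_source i j) -[_ :: _]/(map (line_node i j) (iota 0 L.+1)).
  rewrite map_inj_in_uniq ?iota_uniq // => x y; rewrite !mem_iota => /= xL yL.
  by move=> /(congr1 xcoord); rewrite !xcoord_mknode; lia.
rewrite -(line_node_source i j).
have : (0 + L <= L)%N by [].
elim: {1 3}L 0%N => // c IH x xc /=; apply/andP; split; last first.
  by apply: IH; lia.
have xL : (x < L)%N by lia.
have xy := step_line_node _ _ _ i_n j_m xL; rewrite step_edge //=.
have := online_line_node _ _ _ i_n j_m xL.
have := online_line_node _ _ _ i_n j_m (ltnW xL).
have := step_xcoord _ _ xy; move: xy; rewrite /online.
move: (line_node i j x) (line_node i j x.+1) => u v uv cv /eqP hu /eqP hv.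
have uDv : u != v by apply/eqP => e; move: cv; rewrite e; lia.
have hvu : (ycoord v + 2 ^ i = ycoord u + 2 ^ j)%N.
  by rewrite hu hv cv /line_ht; have := xcoord_le v; rewrite cv; nia.
have : (ycoord v)%:R - (ycoord u)%:R = slope i j.
  by move/(congr1 (GRing.natmul (1 : R))): hvu; rewrite !natrD /slope; lra.
rewrite lines_len2 // /phi cv -[(xcoord u).+1%:R]natr1; move: (slope i j) => s.
move: (_ * _)%:R (ycoord u)%:R (ycoord v)%:R (xcoord u)%:R => M hx hy cx <-.
by apply/eqP; ring.
Qed.

(** * Lines and crossings that survive in the minor *)

Hypothesis L_gt0 : (0 < L)%N.

Lemma minor_line_path (G' : wgraph R node) i j : (i < n)%N -> (j < m)%N ->
  (forall u v, u \in vert G' -> v \in vert G' ->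
     (dist lines_wgraph u v <= dist G' u v)%E) ->
  dist G' (source i) (target j) = dist lines_wgraph (source i) (target j) ->
  exists p, [/\ path (fun x y => [set x; y] \in edges G') (source i) p,
    last (source i) p = target j &
    forall x, x \in source i :: p -> x \in vert G' /\ online i j x].
Proof.
move=> i_n j_m dom dE.
have [|p [sp pt on_p]] :=
  dominating_geodesic _ _ _ _ (phi i j) (psi i j) (source i) (target j)
    (lines_len_potential _ _ i_n j_m) dom.
  by rewrite dE dist_source_target.
exists p; split=> // x xp; split.
  (* The path is nonempty, since source and target lie in different columns. *)
  apply: path_vert sp _ xp; apply/eqP => p0; move: pt; rewrite p0 /=.
  by move/(congr1 xcoord); rewrite !xcoord_mknode //; lia.
(* With this value of [psi], the definition of [psi] becomes the equation of the line. *)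
have : psi i j x = psi i j (source i).
  by move: xp; rewrite inE => /predU1P[-> //|]; apply: on_p.
rewrite /psi xcoord_mknode // ycoord_source // mulr0 subr0 => /eqP.
rewrite subr_eq /slope => /eqP hx; rewrite /online -(eqr_nat R) hx /line_ht.
rewrite natrD !natrM natrB ?xcoord_le //; apply/eqP; ring.
Qed.

Hypothesis Ldiv : forall d, (0 < d <= 2 ^ n + 2 ^ m)%N -> (d %| L)%N.

Lemma step_mono u v u' v' : step u v -> step u' v' ->
  xcoord u = xcoord u' -> (ycoord u < ycoord u')%N -> (ycoord v <= ycoord v')%N.
Proof.
case/andP=> /eqP cv /existsP[i /existsP[j /andP[/eqP hu /eqP hv]]].
case/andP=> /eqP cv' /existsP[i' /existsP[j' /andP[/eqP hu' /eqP hv']]] cu.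
rewrite hu hv hu' hv' cv cv' -cu; apply: line_ht_mono; last first.
  by rewrite -cv xcoord_le.
move=> d /andP[d0 dle]; apply: Ldiv; rewrite d0 (leq_trans dle) //.
by rewrite leq_add // leq_exp2l // ltnW.
Qed.

(** If the two paths of [G'] were disjoint, their preimages would link the same terminals disjointly
    in [lines_graph], although the order of the ends is reversed from left to right. *)
Lemma minor_crossing (K : {set node}) (G' : wgraph R node) i i' j j' :
  minor K lines_graph G' -> (i < i' < n)%N -> (j' < j < m)%N ->
  (forall u v, u \in vert G' -> v \in vert G' ->
     (dist lines_wgraph u v <= dist G' u v)%E) ->
  dist G' (source i) (target j) = dist lines_wgraph (source i) (target j) ->
  dist G' (source i') (target j') =
    dist lines_wgraph (source i') (target j') ->
  exists w, [/\ w \in vert G', online i j w & online i' j' w].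
Proof.
move=> GG' /andP[ii' i'_n] /andP[jj' j_m] dom d1 d2.
have i_n := ltn_trans ii' i'_n; have j'_m := ltn_trans jj' j_m.
have [p [sp pt on_p]] := minor_line_path _ _ _ i_n j_m dom d1.
have [q [sq qt on_q]] := minor_line_path _ _ _ i'_n j'_m dom d2.
pose A := [set x in source i :: p]; pose B := [set x in source i' :: q].
have [AB|] := boolP [disjoint A & B]; last first.
  rewrite -setI_eq0 => /set0Pn[w]; rewrite !inE => /andP[wp wq].
  have [wV w_ij] := on_p w wp; have [_ w_ij'] := on_q w wq.
  by exists w.
have lA : linked G' A (source i) (target j).
  by rewrite -pt; apply: path_linked => // x xp; rewrite finset.in_set.
have lB : linked G' B (source i') (target j').
  by rewrite -qt; apply: path_linked => // x xq; rewrite finset.in_set.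
have [A' [B' [AB' HA HB]]] := minor_linked _ _ _ _ _ _ GG' AB.
exfalso; apply: (layered_paths_meet _ _ xcoord ycoord L step edge_step
  step_xcoord xcoord_le step_mono node_inj _ _ _ _ _ _ AB' L_gt0
  _ _ _ _ _ _ (HA _ _ lA) (HB _ _ lB));
  by rewrite ?xcoord_mknode // ?ycoord_source ?ycoord_target // ltn_mul2r L_gt0
    ltn_exp2l.
Qed.

Lemma online_inj w i j j' : (xcoord w < L)%N -> (0 < xcoord w)%N ->
  online i j w -> online i j' w -> j = j'.
Proof.
rewrite /online /line_ht => wL w0 /eqP -> /eqP /addnI/eqP.
by rewrite eqn_mul2r -[_ == 0%N]negbK -lt0n w0 /= => /eqP/expnI; apply.
Qed.

(** If the two pairs of lines through [w] had different sources, three of the sources would be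
    distinct, and the index inequalities order them for the collinearity argument. *)
Lemma crossing_unique w i1 j1 i1' j1' i2 j2 i2' j2' :
  (i1 < i1')%N -> (j1' < j1)%N -> (i1 < i2')%N -> (i2 < i1')%N ->
  online i1 j1 w -> online i1' j1' w -> online i2 j2 w -> online i2' j2' w ->
  [/\ i1 = i2, j1 = j2, i1' = i2' & j1' = j2'].
Proof.
move=> i1i1' j1j1' i1i2' i2i1' o1 o1' o2 o2'.
have Ei : (2 ^ i1 < 2 ^ i1')%N by rewrite ltn_exp2l.
have Ej : (2 ^ j1' < 2 ^ j1)%N by rewrite ltn_exp2l.
(* On the column at 0 or at [L] the two lines have the heights of distinct sources or distinct
   targets. *)
have [w0 wL] : (0 < xcoord w)%N /\ (xcoord w < L)%N.
  move: o1 o1' (xcoord_le w); rewrite /online /line_ht => /eqP -> /eqP.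
  move=> e wL; split; rewrite ltnNge; apply/negP => c; move: e.
    have -> : xcoord w = 0%N by lia.
    by rewrite !subn0 !muln0; nia.
  have -> : xcoord w = L by lia.
  by rewrite !subnn !muln0; nia.
have p0 : (0 < L - xcoord w)%N by lia.
have no3 a1 b1 a2 b2 a3 b3 : (a1 < a2 < a3)%N ->
    online a1 b1 w -> online a2 b2 w -> online a3 b3 w -> False.
  move=> lt_a /eqP h1 /eqP h2 /eqP h3.
  exact: (no_three_exp2_collinear _ _ _ _ _ _ _ _ _ p0 lt_a
            (esym h1) (esym h2) (esym h3)).
have e : i1 = i2.
  case: (ltngtP i1 i2) => // lt12; exfalso.
    by apply: (no3 i1 j1 i2 j2 i1' j1'); rewrite ?lt12.
  by apply: (no3 i2 j2 i1 j1 i1' j1'); rewrite ?lt12.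
have e' : i1' = i2'.
  case: (ltngtP i1' i2') => // lt12; exfalso.
    by apply: (no3 i1 j1 i1' j1' i2' j2'); rewrite ?lt12 ?i1i1'.
  by apply: (no3 i1 j1 i2' j2' i1' j1'); rewrite ?lt12 ?i1i2'.
subst i2 i2'; split=> //.
  exact: online_inj wL w0 o1 o2.
exact: online_inj wL w0 o1' o2'.
Qed.

End Gadget.

(** * Counting terminals and crossings *)

Lemma minor_terminals (T : finType) (K : {set T}) (G H : sgraph T) :
  minor K G H -> K \subset vert G -> K \subset vert H.
Proof.
by elim=> //= {}H u => [_ IH|v uvH _ IH] uK /IH KH; rewrite subsetD1 KH.
Qed.

Section Counting.
Variables (n m L : nat).
Hypothesis L_gt0 : (0 < L)%N.
Hypothesis Ldiv : forall d, (0 < d <= 2 ^ n + 2 ^ m)%N -> (d %| L)%N.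
Variable R : realType.

Definition terminals : {set node n m L} :=
  [set source n m L i | i : 'I_n] :|: [set target n m L j | j : 'I_m].

Lemma card_terminals : #|terminals| = (n + m)%N.
Proof.
rewrite cardsU disjoint_setI0.
  rewrite cards0 subn0 !card_imset ?card_ord // => i j
    /(congr1 (@ycoord n m L)).
    rewrite !ycoord_target // => /eqP; rewrite eqn_mul2r gtn_eqF //=.
    by move=> /eqP/expnI e; apply: val_inj; apply: e.
  rewrite !ycoord_source // => /eqP; rewrite eqn_mul2r gtn_eqF //=.
  by move=> /eqP/expnI e; apply: val_inj; apply: e.
apply/pred0P => x /=; apply/negP => /andP[/imsetP[i _ ->] /imsetP[j _]].
by move/(congr1 (@xcoord n m L)); rewrite !xcoord_mknode //; lia.
Qed.

(** Sources and targets are split into a lower and an upper block of size [h]. Lines from the lower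
    to the upper block cross all lines from the upper to the lower block, and the blocks supply the
    inequalities that make the crossing determine both lines. *)
Lemma card_minor_crossings h (G' : wgraph R (node n m L)) :
  (h + h <= n)%N -> (h + h <= m)%N ->
  distance_preserving_minor terminals (lines_wgraph n m L R) G' ->
  (forall u v, u \in vert G' -> v \in vert G' ->
    (dist (lines_wgraph n m L R) u v <= dist G' u v)%E) ->
  (h ^ 4 <= #|vert G'|)%N.
Proof.
move=> hn hm [GG' dE] dom.
have sK i : (i < n)%N -> source n m L i \in terminals.
  by move=> i_n; apply/setUP; left; apply/imsetP; exists (Ordinal i_n).
have tK j : (j < m)%N -> target n m L j \in terminals.
  by move=> j_m; apply/setUP; right; apply/imsetP; exists (Ordinal j_m).
have /fin_all_exists[f fP] (q : ('I_h * 'I_h) * ('I_h * 'I_h)) :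
    exists w, [/\ w \in vert G', online n m L q.1.1 (h + q.2.1) w &
                  online n m L (h + q.1.2) q.2.2 w].
  case: q => -[i i'] [j j'] /=.
  have := ltn_ord i; have := ltn_ord i'; have := ltn_ord j; have := ltn_ord j'.
  move=> lj' lj li' li.
  by apply: (minor_crossing _ _ _ R L_gt0 Ldiv _ _ _ _ _ _ GG') => //;
    rewrite ?dE ?sK ?tK //; lia.
have f_inj : injective f.
  move=> [[i1 i1'] [j1 j1']] [[i2 i2'] [j2 j2']] e.
  have := fP (i1, i1', (j1, j1')); have := fP (i2, i2', (j2, j2')).
  rewrite e /= => -[_ o2 o2'] [_ o1 o1'].
  have [||||a b c d] := crossing_unique _ _ _ L_gt0 _ _ _ _ _ _ _ _ _
    _ _ _ _ o1 o1' o2 o2'.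
  - by have := ltn_ord i1; lia.
  - by have := ltn_ord j1'; lia.
  - by have := ltn_ord i1; lia.
  - by have := ltn_ord i2; lia.
  by congr (_, _, (_, _)); apply: val_inj => //; apply: (@addnI h).
have -> : (h ^ 4 =
    #|[set f q | q in [set: ('I_h * 'I_h) * ('I_h * 'I_h)]]|)%N.
  by rewrite card_imset // cardsT !card_prod !card_ord; lia.
apply: subset_leq_card; apply/fintype.subsetP => _ /imsetP[q _ ->].
by case: (fP q).
Qed.

End Counting.

(** * Choice of parameters and the constant *)

Theorem theorem9 (R : realType) :
  exists c : R, 0 < c /\
    forall k : nat, (0 < k)%N ->
      exists (T : finType) (G : wgraph R T) (K : {set T}),
        [/\ K \subset vert G, #|K| = k &
          forall G' : wgraph R T,
            distance_preserving_minor K G G' ->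
            vert G' \subset vert G ->
            (forall u v : T, u \in vert G' -> v \in vert G' ->
              (dist G u v <= dist G' u v)%E) ->
            c * k%:R ^+ 4 <= #|vert G'|%:R].
Proof.
(* Here [4096 = 8 ^ 4], because [k < 4 * h.+1 <= 8 * h] once [h > 0]. *)
exists 4096%:R^-1; split=> [|k k_gt0]; first by rewrite invr_gt0 ltr0n.
pose h := (k %/ 4)%N; pose n := (h + h)%N; pose m := (k - n)%N.
have h4k : (4 * h <= k)%N by rewrite mulnC leq_trunc_div.
have kh4 : (k < 4 * h.+1)%N by rewrite mulnC ltn_ceil.
(* The factorial is a multiple of every possible denominator of a crossing abscissa. *)
pose L := (2 ^ n + 2 ^ m)`!.
have L_gt0 : (0 < L)%N by rewrite fact_gt0.
have Ldiv d : (0 < d <= 2 ^ n + 2 ^ m)%N -> (d %| L)%N by exact: dvdn_fact.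
have KG : terminals n m L \subset vert (lines_wgraph n m L R).
  by apply/fintype.subsetP => x _; rewrite inE.
have Kk : #|terminals n m L| = k.
  by rewrite card_terminals // /m subnKC // /n; lia.
exists (node n m L), (lines_wgraph n m L R), (terminals n m L); split=> //.
move=> G' min _ dom.
have hV : (h ^ 4 <= #|vert G'|)%N.
  by apply: (card_minor_crossings _ _ _ L_gt0 Ldiv _ _ _ _ _ min dom);
    rewrite /m /n; lia.
have kV : (k <= #|vert G'|)%N.
  by rewrite -Kk subset_leq_card // (minor_terminals _ _ _ _ (proj1 min)).
have kV4 : (k ^ 4 <= 4096 * #|vert G'|)%N.
  (* For [k <= 3] no crossings are counted; the surviving terminals give at least one vertex, and
     [3 ^ 4 <= 4096]. *)
  have [h0|h_gt0] := posnP h.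
    have : (k ^ 4 <= 3 ^ 4)%N by rewrite leq_exp2r //; lia.
    by rewrite -[(3 ^ 4)%N]/81%N; lia.
  have : (k ^ 4 <= (8 * h) ^ 4)%N by rewrite leq_exp2r //; lia.
  rewrite expnMn => le_k; apply: leq_trans le_k _.
  by rewrite leq_mul2l hV orbT.
by rewrite ler_pdivrMl ?ltr0n // -natrX -natrM ler_nat.
Qed.
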